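(* Let $\varepsilon,\nu>0$ and let $(\phi_h^0,\mathbf u_h^0),(\phi_h^1,\mathbf u_h^1)\in\mathsf C_h\times\mathsf E_h$ satisfy $(\phi_h^1,1)_h=(\phi_h^0,1)_h$ and $d_h\mathbf u_h^0=d_h\mathbf u_h^1=0$. Then for each $1\le n\le N-1$ the CS-BDF2 scheme $$D_{2\tau}\mathbf u_h^{n+1}+\mathcal B_h(\mathbf u_h^{*,n+1},\mathbf u_h^{n+1})+\nu A_h\mathbf u_h^{n+1}+D_hp_h^{n+1}+\phi_h^{*,n+1}D_h\mu_h^{n+1}=0,$$ $$d_h\mathbf u_h^{n+1}=0,$$ $$D_{2\tau}\phi_h^{n+1}+A_h\mu_h^{n+1}+d_h(\phi_h^{*,n+1}\mathbf u_h^{n+1})=0,$$ $$\mu_h^{n+1}-\varepsilon^2A_h\phi_h^{n+1}-\chi(\phi_h^{\dagger,n+1},\phi_h^{\dagger,n})+\phi_h^{*,n+1}=0,$$ together with the normalization $(p_h^{n+1},1)_h=0$, admits a unique solution $(\mathbf u_h^{n+1},p_h^{n+1},\phi_h^{n+1},\mu_h^{n+1})\in\mathsf E_h\times\mathsf C_h\times\mathsf C_h\times\mathsf C_h$. Moreover, mass is preserved: $$(\phi_h^{n+1},1)_h=(\phi_h^n,1)_h=(\phi_h^0,1)_h .$$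
   Context: Grid. $\Omega=(0,L_x)\times(0,L_y)$; $N_x,N_y$ are positive integers, $h_x=L_x/N_x$, $h_y=L_y/N_y$. $\mathsf C_h$ is the space of cell-centered functions $\varphi_{i+1/2,j+1/2}$, $0\le i<N_x$, $0\le j<N_y$; $\mathsf V_h$ is the space of vertex functions $g_{i,j}$, $0\le i\le N_x$, $0\le j\le N_y$; $\mathsf E_h^x$ consists of $u_{i,j+1/2}$, $1\le i<N_x$, $0\le j<N_y$; $\mathsf E_h^y$ consists of $v_{i+1/2,j}$, $0\le i<N_x$, $1\le j<N_y$; $\mathsf E_h=\mathsf E_h^x\times\mathsf E_h^y$. Boundary and ghost values (no-slip for velocities): for $u\in\mathsf E_h^x$, $u_{0,j+1/2}=u_{N_x,j+1/2}=0$, $u_{i,-1/2}=-u_{i,1/2}$, $u_{i,N_y+1/2}=-u_{i,N_y-1/2}$; for $v\in\mathsf E_h^y$, $v_{i+1/2,0}=v_{i+1/2,N_y}=0$, $v_{-1/2,j}=-v_{1/2,j}$, $v_{N_x+1/2,j}=-v_{N_x-1/2,j}$. Cell-centered functions are extended evenly across the boundary (no-flux): $\varphi_{-1/2,\cdot}=\varphi_{1/2,\cdot}$, etc., so $D_x\varphi$, $D_y\varphi$ vanish on boundary faces. Operators. For each pair of neighbouring grid values in the $x$-direction, the average is half the sum and the difference is (right minus left)$/h_x$; similarly in $y$ with $h_y$. These are denoted $a_x,d_x$ when they map values at integer $x$-indices to half-integer $x$-indices (from $x$-faces to cells, or from vertices to $y$-faces), $A_x,D_x$ when they map values at half-integer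 $x$-indices to integer $x$-indices (from cells to $x$-faces, or from $y$-faces to vertices); $a_y,d_y,A_y,D_y$ are defined analogously in $y$. E.g. $(d_xu)_{i+1/2,j+1/2}=(u_{i+1,j+1/2}-u_{i,j+1/2})/h_x$, $(D_x\varphi)_{i,j+1/2}=(\varphi_{i+1/2,j+1/2}-\varphi_{i-1/2,j+1/2})/h_x$, $(D_yu)_{i,j}=(u_{i,j+1/2}-u_{i,j-1/2})/h_y$. For $\varphi_h\in\mathsf C_h$, $\mathbf v_h=(v_{1,h},v_{2,h})\in\mathsf E_h$: $D_h\varphi_h=(D_x\varphi_h,D_y\varphi_h)\in\mathsf E_h$; $d_h\mathbf v_h=d_xv_{1,h}+d_yv_{2,h}$; $A_h\varphi_h=-d_hD_h\varphi_h$; $A_h\mathbf v_h=(-(D_xd_x+d_yD_y)v_{1,h},-(d_xD_x+D_yd_y)v_{2,h})$; the product is $\varphi_h\mathbf v_h=((A_x\varphi_h)v_{1,h},(A_y\varphi_h)v_{2,h})$ (pointwise on faces). The convection operator $\mathcal B_h(\mathbf u_h,\mathbf v_h)\in\mathsf E_h$ has components $\tfrac12[u_{1,h}D_x(a_xv_{1,h})+A_x(d_x(u_{1,h}v_{1,h}))+a_y(A_xu_{2,h}\,D_yv_{1,h})+d_y(A_yv_{1,h}\,A_xu_{2,h})]$ and $\tfrac12[a_x(A_yu_{1,h}\,D_xv_{2,h})+d_x(A_yu_{1,h}\,A_xv_{2,h})+u_{2,h}D_y(a_yv_{2,h})+A_y(d_y(u_{2,h}v_{2,h}))]$. $(\varphi_h,\psi_h)_h=h_xh_y\sum_{i,j}\varphi_{i+1/2,j+1/2}\psi_{i+1/2,j+1/2}$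 for cell-centered functions. Time. $T>0$, integer $N\ge2$, $\tau=T/N$. For a sequence $q^n$ and $n\ge1$: $D_{2\tau}q^{n+1}=\frac{3q^{n+1}-4q^n+q^{n-1}}{2\tau}$, $q^{*,n+1}=2q^n-q^{n-1}$, $q^{\dagger,n+1}=\frac{3q^{n+1}-q^n}{2}$, $q^{\dagger,n}=\frac{3q^n-q^{n-1}}{2}$. Also $\chi(a,b)=\frac14(a^2+b^2)(a+b)$, applied pointwise. *)

(* Defs.v *)
From mathcomp Require Import all_boot all_order all_algebra.
From mathcomp Require Import reals.

Set Implicit Arguments.
Unset Strict Implicit.
Unset Printing Implicit Defensive.

Import Order.TTheory GRing.Theory Num.Theory.
Local Open Scope ring_scope.

Section Grid.
Variables (R : realType) (Lx Ly : R) (Nx Ny : nat).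

Let hx : R := Lx / Nx%:R.
Let hy : R := Ly / Ny%:R.

(* [phi i j] is phi_{i+1/2,j+1/2}. *)
Definition Ch : Type := 'M[R]_(Nx, Ny).

(* Only the interior faces are stored: for [v : Eh], [v.1 i j] is
   v_{1; i+1,j+1/2} and [v.2 i j] is v_{2; i+1/2,j+1}. *)
Definition Ehx : Type := 'M[R]_(Nx.-1, Ny).
Definition Ehy : Type := 'M[R]_(Nx, Ny.-1).


Definition Eh : Type := (Ehx * Ehy)%type.

(* Grid values at arbitrary points, ghost points included.  In each direction
   the argument [k] stands for the index k, or for the half-integer index
   k + 1/2, according to the kind of point (cell, x-face, y-face, vertex). *)
Definition gridfun := int -> int -> R.

Definition mulgf (f g : gridfun) : gridfun := fun i j => f i j * g i j.

(* Integer indices to half-integer indices. *)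
Definition a_x (f : gridfun) : gridfun := fun i j => (f (i + 1) j + f i j) / 2.
Definition d_x (f : gridfun) : gridfun := fun i j => (f (i + 1) j - f i j) / hx.
Definition a_y (f : gridfun) : gridfun := fun i j => (f i (j + 1) + f i j) / 2.
Definition d_y (f : gridfun) : gridfun := fun i j => (f i (j + 1) - f i j) / hy.

(* Half-integer indices to integer indices: the neighbours of the integer
   index i are i + 1/2 and (i - 1) + 1/2. *)
Definition A_x (f : gridfun) : gridfun := fun i j => (f i j + f (i - 1) j) / 2.
Definition D_x (f : gridfun) : gridfun := fun i j => (f i j - f (i - 1) j) / hx.
Definition A_y (f : gridfun) : gridfun := fun i j => (f i j + f i (j - 1)) / 2.
Definition D_y (f : gridfun) : gridfun := fun i j => (f i j - f i (j - 1)) / hy.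

(* The entry of a matrix, or 0 if the indices are out of range. *)
Definition entry m n (A : 'M[R]_(m, n)) (i j : int) : R :=
  match i, j with
  | Posz k, Posz l =>
      if insub k is Some k' then if insub l is Some l' then A k' l' else 0
      else 0
  | _, _ => 0
  end.

(* Reflection of the ghost indices -1 and n (that is, -1/2 and n + 1/2) across
   the boundary. *)
Definition mirror (n : nat) (k : int) : int :=
  if k == -1 then 0 else if k == n%:Z then n%:Z - 1 else k.

Definition ghost (n : nat) (k : int) : bool := (k == -1) || (k == n%:Z).

Definition ext_c (phi : Ch) : gridfun :=
  fun i j => entry phi (mirror Nx i) (mirror Ny j).

(* The zero normal velocity on the boundary faces comes from the default value
   of [entry]. *)
Definition ext_x (u : Ehx) : gridfun :=
  fun i j => (-1) ^+ ghost Ny j * entry u (i - 1) (mirror Ny j).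

Definition ext_y (v : Ehy) : gridfun :=
  fun i j => (-1) ^+ ghost Nx i * entry v (mirror Nx i) (j - 1).

Definition res_c (f : gridfun) : Ch := \matrix_(i, j) f i%:Z j%:Z.
Definition res_x (f : gridfun) : Ehx := \matrix_(i, j) f (i%:Z + 1) j%:Z.
Definition res_y (f : gridfun) : Ehy := \matrix_(i, j) f i%:Z (j%:Z + 1).

Definition grad_h (phi : Ch) : Eh :=
  (res_x (D_x (ext_c phi)), res_y (D_y (ext_c phi))).

Definition div_h (v : Eh) : Ch :=
  res_c (fun i j => d_x (ext_x v.1) i j + d_y (ext_y v.2) i j).

Definition Ah_c (phi : Ch) : Ch := - div_h (grad_h phi).

Definition Ah_v (v : Eh) : Eh :=
  let V1 := ext_x v.1 in let V2 := ext_y v.2 in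
  (res_x (fun i j => - (D_x (d_x V1) i j + d_y (D_y V1) i j)),
   res_y (fun i j => - (d_x (D_x V2) i j + D_y (d_y V2) i j))).

Definition scale_h (phi : Ch) (v : Eh) : Eh :=
  (res_x (mulgf (A_x (ext_c phi)) (ext_x v.1)),
   res_y (mulgf (A_y (ext_c phi)) (ext_y v.2))).

Definition Bh (u v : Eh) : Eh :=
  let U1 := ext_x u.1 in let U2 := ext_y u.2 in
  let V1 := ext_x v.1 in let V2 := ext_y v.2 in
  (res_x (fun i j =>
     (U1 i j * D_x (a_x V1) i j
      + A_x (d_x (mulgf U1 V1)) i j
      + a_y (mulgf (A_x U2) (D_y V1)) i j
      + d_y (mulgf (A_y V1) (A_x U2)) i j) / 2),
   res_y (fun i j =>
     (a_x (mulgf (A_y U1) (D_x V2)) i j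
      + d_x (mulgf (A_y U1) (A_x V2)) i j
      + U2 i j * D_y (a_y V2) i j
      + A_y (d_y (mulgf U2 V2)) i j) / 2)).

Definition dot_h (phi psi : Ch) : R :=
  hx * hy * \sum_(i < Nx) \sum_(j < Ny) phi i j * psi i j.

Definition mass_h (phi : Ch) : R := dot_h phi (const_mx 1).

Section Scheme.
Variables (tau eps nu : R).

(* In the four formulas below [q0], [q1], [q2] are the values at the successive
   times n-1, n, n+1. *)
Definition D2tau (V : lmodType R) (q0 q1 q2 : V) : V :=
  (2 * tau)^-1 *: (3 *: q2 - 4 *: q1 + q0).

Definition star (V : lmodType R) (q0 q1 : V) : V := 2 *: q1 - q0.

Definition dagger (V : lmodType R) (q1 q2 : V) : V := 2^-1 *: (3 *: q2 - q1).

Definition chi (a b : R) : R := 4^-1 * (a ^+ 2 + b ^+ 2) * (a + b).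

Definition chi_h (a b : Ch) : Ch := map2_mx chi a b.

(* One step of the scheme, from the data at times n-1 (index 0) and n (index 1)
   to the solution (index 2) at time n+1. *)
Definition cs_bdf2_step (u0 u1 : Eh) (phi0 phi1 : Ch)
    (u2 : Eh) (p2 phi2 mu2 : Ch) : Prop :=
  [/\ D2tau u0 u1 u2 + Bh (star u0 u1) u2 + nu *: Ah_v u2 + grad_h p2
        + scale_h (star phi0 phi1) (grad_h mu2) = 0,
      div_h u2 = 0,
      D2tau phi0 phi1 phi2 + Ah_c mu2 + div_h (scale_h (star phi0 phi1) u2) = 0,
      mu2 - eps ^+ 2 *: Ah_c phi2
        - chi_h (dagger phi1 phi2) (dagger phi0 phi1)
        + star phi0 phi1 = 0
    & mass_h p2 = 0].

End Scheme.
End Grid.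

(* Main.v *)
Require Import Defs.
From HB Require Import structures.
From mathcomp Require Import all_boot all_order all_algebra.
From mathcomp Require Import reals all_classical all_analysis ring lra zify.
Import Order.TTheory GRing.Theory Num.Theory numFieldNormedType.Exports.
Set Implicit Arguments.
Unset Strict Implicit.
Unset Printing Implicit Defensive.
Local Open Scope ring_scope.

(* For a given value r of the nonlinear term the scheme is a square linear
   system in (u, p, phi, mu).  Testing the momentum equation with u and the
   phase equation with mu cancels the convection, the pressure and the coupling
   terms (summation by parts) and leaves, with c = 3/(2 tau),
     c |u|^2 + nu (A u, u) + |D mu|^2 + c eps^2 |D phi|^2 + c (phi, r) = 0.
   So the linear system is invertible, and the linear part K of r |-> phi
   satisfies (K r, r) <= 0, with equality only if K r = 0.  As chi is monotone
   in its first argument, the same identity applied to a difference of two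
   solutions gives uniqueness.  Existence amounts to solving
   r = g (K r) for a monotone coercive cubic g acting pointwise: |r - g (K r)|^2
   attains its minimum, and at a minimizer it vanishes because the derivative
   w |-> w - g' K w is invertible.  Mass is preserved because every discrete
   divergence has zero mean. *)

(** * Calculus and the monotone, coercive cubic [chi] *)

Lemma is_derive_continuous (R : realType) (g : R -> R) (x dg : R) :
  is_derive x 1 g dg -> {for x, continuous g}.
Proof. by move=> [gx _]; apply/differentiable_continuous/derivable1_diffP. Qed.

Lemma continuous_bigsum (R : realType) (T : topologicalType) n
    (F : 'I_n -> T -> R) (x : T) :
  (forall i, {for x, continuous (F i)}) ->
  {for x, continuous (fun y => \sum_i F i y)}.
Proof.
by move=> Fc; apply: cvg_big => [|i _]; [exact: add_continuous|exact: Fc].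
Qed.

Lemma is_derive_chi_affine (R : realType) (a b x : R) :
  is_derive x 1 (fun y => chi (3 / 2 * y + a) b)
    (3 / 8 * (2 * (3 / 2 * x + a) ^+ 2 + ((3 / 2 * x + a) + b) ^+ 2)).
Proof.
have affine : is_derive x 1 (fun y => 3 / 2 * y + a) (3 / 2).
  have := is_deriveD (is_deriveZ (3 / 2) (is_derive_id x 1)) (is_derive_cst a x 1).
  by rewrite addr0 /GRing.scale/= mulr1.
pose z : R -> R := fun y => 3 / 2 * y + a.
rewrite (_ : (fun y => _) = 4^-1 \*: (z ^+ 2 + cst (b ^+ 2)) * (z + cst b));
  last exact/funext.
apply: (is_derive_eq (is_deriveM (is_deriveZ 4^-1 (is_deriveD (is_deriveX 2 affine)
  (is_derive_cst (b ^+ 2) x 1))) (is_deriveD affine (is_derive_cst b x 1)))).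
by rewrite !fctE /GRing.scale/= -[4^-1 *: _]/(4^-1 * _) /z; field.
Qed.

(** The difference quotient of [chi] in its first argument is a sum of three squares, up to the
    factor 1/8. *)
Lemma chi_affine_monotone (R : realType) (a b x y : R) :
  0 <= (x - y) * (chi (3 / 2 * x + a) b - chi (3 / 2 * y + a) b).
Proof.
set z := 3 / 2 * x + a; set z' := 3 / 2 * y + a.
have -> : (x - y) * (chi z b - chi z' b) =
    3 / 16 * (x - y) ^+ 2 * ((z + z') ^+ 2 + (z + b) ^+ 2 + (z' + b) ^+ 2).
  by rewrite /chi /z /z'; field.
by rewrite mulr_ge0 ?addr_ge0 ?sqr_ge0// mulr_ge0 ?sqr_ge0// divr_ge0.
Qed.

Lemma cubic_coercive (R : realFieldType) (p q r d M : R) : 0 < p ->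
  exists B, forall x s, `|s| <= M ->
    x ^+ 2 <= x * (p * x ^+ 3 + q * x ^+ 2 + r * x + d + s) + B.
Proof.
(* Half of the quartic term completes a square with the cubic term, the other half one with the
   quadratic term. This [k] makes the coefficients of [x ^+ 2] agree; the last summand of B pays for
   the square completed with [x * (d + s)]. *)
move=> p_gt0; pose k := q ^+ 2 / (2 * p) - r + 3 / 2.
exists (k ^+ 2 / (2 * p) + (M + `|d|) ^+ 2 / 2) => x s sM.
have le_sd : (d + s) ^+ 2 <= (M + `|d|) ^+ 2.
  rewrite -[leLHS]real_normK ?num_real// ler_pXn2r ?nnegrE ?addr_ge0//.
    by rewrite (le_trans (ler_normD _ _))// addrC lerD2r.
  by rewrite (le_trans _ sM).
have -> : x * (p * x ^+ 3 + q * x ^+ 2 + r * x + d + s)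
    + (k ^+ 2 / (2 * p) + (M + `|d|) ^+ 2 / 2) =
    x ^+ 2 + p / 2 * (x ^+ 2 - k / p) ^+ 2 + p / 2 * (x * (x + q / p)) ^+ 2
    + (x + d + s) ^+ 2 / 2 + ((M + `|d|) ^+ 2 - (d + s) ^+ 2) / 2.
  by rewrite /k; field; rewrite gt_eqF.
have p2 : 0 <= p / 2 by rewrite divr_ge0// ltW.
have := mulr_ge0 p2 (sqr_ge0 (x ^+ 2 - k / p)).
have := mulr_ge0 p2 (sqr_ge0 (x * (x + q / p))).
have := sqr_ge0 (x + d + s).
by lra.
Qed.

Lemma chi_affine_coercive (R : realType) (a b M : R) :
  exists B, forall x s, `|s| <= M ->
    x ^+ 2 <= x * (chi (3 / 2 * x + a) b + s) + B.
Proof.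
(* These are the coefficients of [chi (3 / 2 * x + a) b] in powers of [x]; the leading one is
   (3/2)^3 / 4. *)
have [|B HB] := @cubic_coercive R (27 / 32) (9 / 16 * (3 * a + b))
  (3 / 8 * (3 * a ^+ 2 + 2 * a * b + b ^+ 2)) (chi a b) M; first by lra.
exists B => x s /(HB x); congr (_ <= _ * (_ + _) + _).
by rewrite /chi; field.
Qed.

(** * A fixed-point theorem for a dissipative linear map followed by a monotone map *)

Section MonotoneFixpoint.
Local Open Scope classical_set_scope.
Local Open Scope ring_scope.
Variables (R : realType) (n : nat) (K : 'M[R]_n) (g g' : 'I_n -> R -> R).
Hypothesis K_le0 : forall r : 'rV_n, \sum_i (r *m K) 0 i * r 0 i <= 0.
Hypothesis K_eq0 : forall r : 'rV_n,
  \sum_i (r *m K) 0 i * r 0 i = 0 -> r *m K = 0.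
Hypothesis g_derive : forall i (x : R), is_derive x 1 (g i) (g' i x).
Hypothesis g'_ge0 : forall i x, 0 <= g' i x.
Hypothesis g_coercive : forall i (M : R), exists B : R, forall x s : R,
  `|s| <= M -> x ^+ 2 <= x * (g i x + s) + B.

Let defect (r : 'rV[R]_n) i : R := r 0 i - g i ((r *m K) 0 i).
Let cost (r : 'rV[R]_n) : R := \sum_i defect r i ^+ 2.

(** A kernel vector satisfies w = g' K w coordinatewise, so pairing w with K w gives a sum of terms
    g' (K w)^2 >= 0. Dissipativity makes this sum zero, hence K w = 0 and then w = 0. *)
Lemma linearization_unit (x : 'I_n -> R) :
  1%:M - K *m diag_mx (\row_i g' i (x i)) \in unitmx.
Proof.
rewrite -row_free_unit; apply: inj_row_free => w.
rewrite mulmxBr mulmx1 mulmxA => /eqP; rewrite subr_eq0 => /eqP wE.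
have wiE i : w 0 i = (w *m K) 0 i * g' i (x i).
  by rewrite {1}wE mul_mx_diag !mxE.
suff wK : w *m K = 0 by rewrite wE wK mul0mx.
apply/K_eq0/le_anti; rewrite K_le0 sumr_ge0// => i _.
by rewrite wiE mulrA -expr2 mulr_ge0 ?sqr_ge0.
Qed.

(** As K may be singular, r is bounded in two stages. Summing the coercivity inequality at x = K r,
    where g x + defect = r, and using that the pairing of K r with r is nonpositive bounds K r. Then
    r = g (K r) + defect is bounded because g is bounded on compact intervals. *)
Lemma defect_bounded (M : R) :
  exists C : R, forall r, (forall i, `|defect r i| <= M) ->
    forall i, `|r 0 i| <= C.
Proof.
have [B gB] := choice (g_coercive^~ M).
pose b := Num.sqrt (\sum_i B i).
have gbnd i : exists C, forall x, x \in `[- b, b] -> `|g i x| <= C.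
  have b0 : - b <= b by rewrite ge0_cp ?sqrtr_ge0.
  have cg : {within `[- b, b]%classic, continuous (fun x => `|g i x|)}.
    apply: continuous_subspaceT => x; apply: continuous_comp.
      exact: is_derive_continuous (g_derive i x).
    exact: norm_continuous.
  by have [c _ cmax] := EVT_max b0 cg; exists `|g i c|.
have [C gC] := choice gbnd.
exists (M + \sum_i `|C i|) => r rM i.
have rE j : r 0 j = g j ((r *m K) 0 j) + defect r j.
  by rewrite /defect addrC subrK.
have sum_le : \sum_j (r *m K) 0 j ^+ 2 <= \sum_i B i.
  rewrite -[leRHS]add0r.
  apply: (@le_trans _ _ (\sum_j ((r *m K) 0 j * r 0 j + B j))).
    by apply: ler_sum => j _; rewrite rE gB.
  by rewrite big_split/= lerD2r K_le0.
have xb : (r *m K) 0 i \in `[- b, b].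
  rewrite in_itv/= -ler_norml -sqrtr_sqr ler_wsqrtr//.
  apply: le_trans sum_le; rewrite (bigD1 i)//= lerDl.
  by apply: sumr_ge0 => j _; rewrite sqr_ge0.
rewrite rE (le_trans (ler_normD _ _))// addrC lerD//.
apply: le_trans (gC _ _ xb) _; apply: le_trans (ler_norm _) _.
by rewrite (bigD1 i)//= lerDl sumr_ge0.
Qed.

Lemma cost_continuous : continuous cost.
Proof.
rewrite /cost => r.
have coord_cont j : {for r, continuous (fun v : 'rV[R]_n => v 0 j)}.
  exact: (@coord_continuous R 1 n 0 j r).
apply: continuous_bigsum => i.
have Kc : {for r, continuous (fun v : 'rV[R]_n => (v *m K) 0 i)}.
  rewrite (_ : (fun _ => _) = fun v : 'rV_n => \sum_j v 0 j * K j i).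
    apply: continuous_bigsum => j.
    by apply: continuousM; [exact: coord_cont|exact: cst_continuous].
  by apply/funext => v; rewrite mxE.
have gc : {for r, continuous (fun v : 'rV[R]_n => g i ((v *m K) 0 i))}.
  exact: (continuous_comp Kc (is_derive_continuous (g_derive i _))).
have dc : {for r, continuous (defect^~ i)} := continuousB (coord_cont i) gc.
rewrite (_ : (fun _ => _) = (defect^~ i) \* (defect^~ i)); last exact/funext.
exact: continuousM.
Qed.

Lemma cost_minimum : exists c, forall r, cost c <= cost r.
Proof.
(* If d^2 <= [cost 0], then |d| <= 1 + d^2 <= 1 + [cost 0]. So the box of radius C contains the
   whole sublevel set of [cost 0], and a minimum over the box is global. *)
have [C HC] := defect_bounded (1 + cost 0).
have bnd r : cost r <= cost 0 -> forall i, `|r 0 i| <= C.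
  move=> r0; apply: HC => i.
  have : defect r i ^+ 2 <= cost 0.
    apply: le_trans r0; rewrite /cost (bigD1 i)//= lerDl sumr_ge0// => j _.
    exact: sqr_ge0.
  rewrite -real_normK ?num_real//.
  by have := normr_ge0 (defect r i); nra.
pose A := [set r : 'rV[R]_n | forall i, `[- C, C]%classic (r ord0 i)]%classic.
have AE r : A r <-> forall i, `|r 0 i| <= C.
  by split=> Ar i; have := Ar i; rewrite /= in_itv/= ler_norml.
have A0 : A 0 by apply/AE; exact: bnd.
have cA : compact A.
  exact: (@rV_compact R n (fun=> `[- C, C]%classic) (fun=> @segment_compact R _ _)).
have [|c _ cmin] := @EVT_min_rV _ _ cost _ (ex_intro _ 0 A0) cA.
  exact/continuous_subspaceT/cost_continuous.
exists c => r; have [r0|/ltW r0] := leP (cost r) (cost 0).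
  by apply: cmin; rewrite inE; exact/AE/bnd.
by apply: le_trans r0; apply: cmin; rewrite inE.
Qed.

Lemma monotone_fixpoint :
  exists r : 'rV_n, forall i, r 0 i = g i ((r *m K) 0 i).
Proof.
have [c cmin] := cost_minimum; exists c => i.
pose x j := (c *m K) 0 j.
pose f := \row_j defect c j.
(* The Newton direction up to sign: along w the defect at c has itself as derivative, so the cost
   has derivative twice the sum of the squared defects, which must vanish at a minimizer. *)
have [w wE] : exists w : 'rV_n, forall j,
    w 0 j - (w *m K) 0 j * g' j (x j) = defect c j.
  exists (f *m invmx (1%:M - K *m diag_mx (\row_j g' j (x j)))) => j.
  have := mulmxKV (linearization_unit x) f; move: (f *m invmx _) => w /rowP/(_ j).
  by rewrite mulmxBr mulmx1 mulmxA mul_mx_diag [f 0 j]mxE => <-; rewrite !mxE.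
pose h (t : R) := cost (c + t *: w).
have dlin (a b t : R) : is_derive t 1 (fun s => a + s * b) b.
  rewrite (_ : (fun _ => _) = cst a + b *: id); last first.
    by apply/funext => s /=; rewrite mulrC.
  have := is_deriveD (is_derive_cst a t 1) (is_deriveZ b (is_derive_id t 1)).
  by rewrite add0r /GRing.scale/= mulr1.
have ddefect (t : R) j : is_derive t 1 (fun s => defect (c + s *: w) j)
    (w 0 j - (w *m K) 0 j * g' j (((c + t *: w) *m K) 0 j)).
  have lin (A : 'rV[R]_n) (B : 'rV[R]_n) :
      is_derive t 1 (fun s => (A + s *: B) 0 j) (B 0 j).
    by under eq_fun do rewrite 2!mxE.
  have linK : is_derive t 1 (fun s => ((c + s *: w) *m K) 0 j) ((w *m K) 0 j).
    by under eq_fun do rewrite mulmxDl -scalemxAl.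
  rewrite mulrC.
  exact: is_deriveB (lin c w) (is_derive1_comp (g_derive j _) linK).
have dh (t : R) : is_derive t 1 h (\sum_j 2 * defect (c + t *: w) j *
    (w 0 j - (w *m K) 0 j * g' j (((c + t *: w) *m K) 0 j))).
  rewrite (_ : h = \sum_j (fun t => defect (c + t *: w) j) ^+ 2); last first.
    by apply/funext => s; rewrite /h /cost fct_sumE; apply: eq_bigr.
  by apply: is_derive_sum.
have h0 : is_derive (0 : R) 1 h 0.
  apply: (@derive1_at_min _ h (-1) 1); rewrite ?in_itv/=; try lra.
  - by move=> t _; case: (dh t).
  - by move=> t _; rewrite /h scale0r addr0.
have : \sum_j 2 * defect c j ^+ 2 = 0.
  have := dh 0; rewrite scale0r addr0 => dh0.
  have := @derive_val _ _ _ _ _ _ _ dh0; rewrite (@derive_val _ _ _ _ _ _ _ h0).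
  by move=> dE; rewrite [RHS]dE; apply: eq_bigr => j _; rewrite wE mulrA.
move/eqP; rewrite psumr_eq0 => [/allP/(_ i (mem_index_enum _))|j _]; last first.
  by rewrite mulr_ge0 ?sqr_ge0.
by rewrite /= mulf_eq0 pnatr_eq0/= sqrf_eq0 subr_eq0 => /eqP.
Qed.

End MonotoneFixpoint.

(** In finite dimension an injective endomorphism is onto. Linearity is a hypothesis on a bare
    function because the discrete operators are plain functions. *)
Lemma linear_inverse (F : fieldType) (V : vectType F) (f : V -> V) :
  (forall a x y, f (a *: x + y) = a *: f x + f y) ->
  (forall x, f x = 0 -> x = 0) ->
  exists2 g : V -> V, forall a x y, g (a *: x + y) = a *: g x + g y & cancel g f.
Proof.
move=> f_lin f0.
pose fL : {linear V -> V} := HB.pack f (GRing.isLinear.Build F V V _ f f_lin).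
have ker0 : lker (linfun fL) == 0%VS.
  rewrite -subv0; apply/subvP => x; rewrite memv_ker lfunE memv0 => /eqP/f0 ->.
  by rewrite eqxx.
exists (linfun fL)^-1%VF => [t x y|x]; first exact: linearP.
by rewrite -[LHS](lfunE fL) (lker0_lfunVK ker0).
Qed.

(** * Linearity of the discrete operators *)

Section Operators.
Variables (R : realType) (Lx Ly : R) (Nx Ny : nat).
Implicit Types (phi psi : Ch R Nx Ny) (u v w : Eh R Nx Ny) (i j : int).

Lemma linear_map0 (V W : lmodType R) (f : V -> W) :
  (forall a x y, f (a *: x + y) = a *: f x + f y) -> f 0 = 0.
Proof. by move=> fD; rewrite -[0 in LHS](addNr 0) -scaleN1r fD scaleN1r addNr. Qed.

Lemma entryD m n (A B : 'M[R]_(m, n)) a i j :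
  entry (a *: A + B) i j = a * entry A i j + entry B i j.
Proof.
case: i => k; case: j => l /=; rewrite ?mulr0 ?addr0//.
case: insub => [k'|]; rewrite ?mulr0 ?addr0//.
by case: insub => [l'|]; rewrite ?mulr0 ?addr0// !mxE.
Qed.

Lemma entry_ord m n (A : 'M[R]_(m, n)) (i : 'I_m) (j : 'I_n) :
  entry A i%:Z j%:Z = A i j.
Proof. by rewrite /= !valK. Qed.

Lemma entry_row_out m n (A : 'M[R]_(m, n)) i j :
  (i < 0) || (m%:Z <= i) -> entry A i j = 0.
Proof.
case: i => k; case: j => l //=; rewrite lez_nat => mk.
by rewrite insubF// ltnNge mk.
Qed.

Lemma entry_col_out m n (A : 'M[R]_(m, n)) i j :
  (j < 0) || (n%:Z <= j) -> entry A i j = 0.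
Proof.
case: i => k; case: j => l //=; rewrite lez_nat => nl.
by case: insub => // k'; rewrite insubF// ltnNge nl.
Qed.

Lemma ext_cD a phi psi i j :
  ext_c (a *: phi + psi : Ch R Nx Ny) i j = a * ext_c phi i j + ext_c psi i j.
Proof. exact: entryD. Qed.

Lemma ext_xD a (u v : Ehx R Nx Ny) i j :
  ext_x (a *: u + v : Ehx R Nx Ny) i j = a * ext_x u i j + ext_x v i j.
Proof. by rewrite /ext_x entryD; ring. Qed.

Lemma ext_yD a (u v : Ehy R Nx Ny) i j :
  ext_y (a *: u + v : Ehy R Nx Ny) i j = a * ext_y u i j + ext_y v i j.
Proof. by rewrite /ext_y entryD; ring. Qed.

Lemma grad_hD a phi psi :
  grad_h Lx Ly (a *: phi + psi : Ch R Nx Ny) =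
  a *: grad_h Lx Ly phi + grad_h Lx Ly psi.
Proof.
by congr pair; apply/matrixP => i j; rewrite !mxE /D_x /D_y !ext_cD; ring.
Qed.

Lemma div_hD a u v :
  div_h Lx Ly (a *: u + v : Eh R Nx Ny) = a *: div_h Lx Ly u + div_h Lx Ly v.
Proof.
by apply/matrixP => i j; rewrite !mxE /d_x /d_y !ext_xD !ext_yD; ring.
Qed.

Lemma Ah_cD a phi psi :
  Ah_c Lx Ly (a *: phi + psi : Ch R Nx Ny) =
  a *: Ah_c Lx Ly phi + Ah_c Lx Ly psi.
Proof. by rewrite /Ah_c grad_hD div_hD scalerN opprD. Qed.

Lemma Ah_vD a u v :
  Ah_v Lx Ly (a *: u + v : Eh R Nx Ny) = a *: Ah_v Lx Ly u + Ah_v Lx Ly v.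
Proof.
congr pair; apply/matrixP => i j; rewrite !mxE.
  by rewrite /D_x /d_x /D_y /d_y !ext_xD; ring.
by rewrite /D_x /d_x /D_y /d_y !ext_yD; ring.
Qed.

Lemma scale_hD a phi u v :
  scale_h phi (a *: u + v : Eh R Nx Ny) = a *: scale_h phi u + scale_h phi v.
Proof.
congr pair; apply/matrixP => i j; rewrite !mxE /mulgf.
  by rewrite ext_xD; ring.
by rewrite ext_yD; ring.
Qed.

Lemma Bh_D a w u v :
  Bh Lx Ly w (a *: u + v : Eh R Nx Ny) = a *: Bh Lx Ly w u + Bh Lx Ly w v.
Proof.
congr pair; apply/matrixP => i j; rewrite !mxE.
  by rewrite /A_x /a_x /A_y /a_y /D_x /d_x /D_y /d_y /mulgf !ext_xD; ring.
by rewrite /A_x /a_x /A_y /a_y /D_x /d_x /D_y /d_y /mulgf !ext_yD; ring.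
Qed.

(** * Interior, boundary and ghost values *)

Hypotheses (Nx_gt0 : (0 < Nx)%N) (Ny_gt0 : (0 < Ny)%N).

Lemma mirror_in n k : (k < n)%N -> mirror n k = k.
Proof. by rewrite /mirror => kn; rewrite eqz_nat ltn_eqF. Qed.

Lemma ghost_in n k : (k < n)%N -> ghost n k = false.
Proof. by rewrite /ghost => kn; rewrite eqz_nat ltn_eqF. Qed.

Lemma mirror_right n : mirror n n = n%:Z - 1.
Proof. by rewrite /mirror eqxx. Qed.

Lemma ghost_right n : ghost n n.
Proof. by rewrite /ghost eqxx orbT. Qed.

Lemma ext_x_face (v : Ehx R Nx Ny) (k : 'I_Nx.-1) (l : 'I_Ny) :
  ext_x v (k%:Z + 1) l%:Z = v k l.
Proof. by rewrite /ext_x ghost_in// mirror_in// addrK mul1r entry_ord. Qed.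

Lemma ext_y_face (v : Ehy R Nx Ny) (k : 'I_Nx) (l : 'I_Ny.-1) :
  ext_y v k%:Z (l%:Z + 1) = v k l.
Proof. by rewrite /ext_y ghost_in// mirror_in// addrK mul1r entry_ord. Qed.

Lemma ext_c_cell phi (k : 'I_Nx) (l : 'I_Ny) : ext_c phi k%:Z l%:Z = phi k l.
Proof. by rewrite /ext_c !mirror_in// entry_ord. Qed.

(** Faces 0 and [Nx] are looked up in rows -1 and [Nx] - 1, just outside the [Nx.-1] stored rows, so
    [entry] returns its default 0. *)
Lemma ext_x_left (v : Ehx R Nx Ny) j : ext_x v 0 j = 0.
Proof. by rewrite /ext_x entry_row_out ?mulr0. Qed.

Lemma ext_x_right (v : Ehx R Nx Ny) j : ext_x v Nx j = 0.
Proof. by rewrite /ext_x entry_row_out ?mulr0//; lia. Qed.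

Lemma ext_y_bottom (v : Ehy R Nx Ny) i : ext_y v i 0 = 0.
Proof. by rewrite /ext_y entry_col_out ?mulr0. Qed.

Lemma ext_y_top (v : Ehy R Nx Ny) i : ext_y v i Ny = 0.
Proof. by rewrite /ext_y entry_col_out ?mulr0//; lia. Qed.

Lemma ext_x_ghost_bottom (v : Ehx R Nx Ny) i : ext_x v i (-1) = - ext_x v i 0.
Proof. by rewrite /ext_x ghost_in// mirror_in// mulN1r mul1r. Qed.

Lemma ext_x_ghost_top (v : Ehx R Nx Ny) i :
  ext_x v i Ny = - ext_x v i (Ny%:Z - 1).
Proof.
have -> : Ny%:Z - 1 = Ny.-1 by lia.
rewrite /ext_x ghost_right mirror_right ghost_in ?mirror_in ?prednK// mulN1r mul1r.
by congr (- entry _ _ _); lia.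
Qed.

Lemma ext_y_ghost_left (v : Ehy R Nx Ny) j : ext_y v (-1) j = - ext_y v 0 j.
Proof. by rewrite /ext_y ghost_in// mirror_in// mulN1r mul1r. Qed.

Lemma ext_y_ghost_right (v : Ehy R Nx Ny) j :
  ext_y v Nx j = - ext_y v (Nx%:Z - 1) j.
Proof.
have -> : Nx%:Z - 1 = Nx.-1 by lia.
rewrite /ext_y ghost_right mirror_right ghost_in ?mirror_in ?prednK// mulN1r mul1r.
by congr (- entry _ _ _); lia.
Qed.

(** * Summation by parts *)

Definition cell_sum (F : gridfun R) : R := \sum_(i < Nx) \sum_(j < Ny) F i j.

(* A discrete divergence with vanishing boundary fluxes has zero sum; every
   summation by parts below is an instance with explicit fluxes [H] and [K]. *)
Lemma cell_sum_flux (F P H K : gridfun R) :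
  (forall j, H 0 j = 0) -> (forall j, H Nx j = 0) ->
  (forall i, K i 0 = 0) -> (forall i, K i Ny = 0) ->
  (forall i j, F i j = H (i + 1) j - H i j + (K i (j + 1) - K i j) + P i j) ->
  cell_sum F = cell_sum P.
Proof.
have telescope (f : int -> R) m :
    \sum_(k < m) (f (k%:Z + 1) - f k%:Z) = f m - f 0.
  elim: m => [|m IH]; first by rewrite big_ord0 subrr.
  rewrite big_ord_recr/= IH (_ : m%:Z + 1 = m.+1); last by lia.
  by rewrite addrC addrA subrK.
move=> H0 HN K0 KN FE; rewrite /cell_sum.
under eq_bigr do under eq_bigr do rewrite FE.
under eq_bigr do rewrite 2!big_split/= telescope K0 KN subrr addr0.
(* The y-fluxes have telescoped in the inner sum; the x-fluxes telescope after the sums are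
   exchanged. *)
rewrite big_split/= exchange_big/= big1 ?add0r// => j _.
by rewrite (telescope (H^~ j)) H0 HN subrr.
Qed.

Definition mxdot m n (A B : 'M[R]_(m, n)) : R := \sum_i \sum_j A i j * B i j.

Definition dot_e u v : R := mxdot u.1 v.1 + mxdot u.2 v.2.

Lemma mxdot_sqr_ge0 m n (A : 'M[R]_(m, n)) : 0 <= mxdot A A.
Proof. by do 2![apply: sumr_ge0 => ? _]; rewrite -expr2 sqr_ge0. Qed.

Lemma mxdot_sqr_eq0 m n (A : 'M[R]_(m, n)) : mxdot A A = 0 -> A = 0.
Proof.
move/eqP; rewrite /mxdot pair_big psumr_eq0 => [/allP A0|[i j] _]; last first.
  by rewrite /= -expr2 sqr_ge0.
apply/matrixP => i j; have := A0 (i, j) (mem_index_enum _).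
by rewrite /= -expr2 sqrf_eq0 mxE => /eqP.
Qed.

Lemma mxdot_res (f : gridfun R) phi :
  mxdot (res_c Nx Ny f) phi = cell_sum (mulgf f (ext_c phi)).
Proof.
by apply: eq_bigr => i _; apply: eq_bigr => j _; rewrite mxE /mulgf ext_c_cell.
Qed.

(** Assigning to each cell its left and lower faces adds only boundary faces, where the velocity is
    zero. Face products thus become cell sums, to which [cell_sum_flux] applies. *)
Lemma dot_e_res (f g : gridfun R) v :
  dot_e (res_x Nx Ny f, res_y Nx Ny g) v =
  cell_sum (fun i j => f i j * ext_x v.1 i j + g i j * ext_y v.2 i j).
Proof.
have shift m (F : int -> R) : (0 < m)%N -> F 0 = 0 ->
    \sum_(k < m.-1) F (k%:Z + 1) = \sum_(k < m) F k%:Z.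
  case: m => // m _ F0; rewrite big_ord_recl F0 add0r.
  by apply: eq_bigr => k _; rewrite lift0 intS addrC.
rewrite /cell_sum; under [RHS]eq_bigr do rewrite big_split/=.
rewrite [RHS]big_split/=; congr (_ + _).
  rewrite -(shift _ (fun i => \sum_(j < Ny) f i j * ext_x v.1 i j))//; last first.
    by rewrite big1// => j _; rewrite ext_x_left mulr0.
  apply: eq_bigr => i _; apply: eq_bigr => j _.
  by rewrite ext_x_face mxE.
apply: eq_bigr => i _.
rewrite -(shift _ (fun j => g i j * ext_y v.2 i j))//; last first.
  by rewrite ext_y_bottom mulr0.
by apply: eq_bigr => j _; rewrite ext_y_face mxE.
Qed.

Lemma grad_div_adjoint phi v :
  dot_e (grad_h Lx Ly phi) v = - mxdot (div_h Lx Ly v) phi.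
Proof.
rewrite dot_e_res mxdot_res; apply/eqP; rewrite -subr_eq0 opprK.
rewrite /cell_sum -big_split; under eq_bigr do rewrite -big_split.
rewrite -[X in X == _]/(cell_sum (fun i j =>
  D_x Lx Nx (ext_c phi) i j * ext_x v.1 i j
  + D_y Ly Ny (ext_c phi) i j * ext_y v.2 i j
  + mulgf (fun i j => d_x Lx Nx (ext_x v.1) i j + d_y Ly Ny (ext_y v.2) i j)
      (ext_c phi) i j)).
(* The discrete product rule: the flux through a face is its normal velocity times the cell value on
   its left, or below it. *)
rewrite (@cell_sum_flux _ (fun _ _ => 0)
  (fun i j => ext_c phi (i - 1) j * ext_x v.1 i j / (Lx / Nx%:R))
  (fun i j => ext_c phi i (j - 1) * ext_y v.2 i j / (Ly / Ny%:R))).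
- by rewrite /cell_sum big1// => i _; rewrite big1.
- by move=> j; rewrite ext_x_left mulr0 mul0r.
- by move=> j; rewrite ext_x_right mulr0 mul0r.
- by move=> i; rewrite ext_y_bottom mulr0 mul0r.
- by move=> i; rewrite ext_y_top mulr0 mul0r.
- by move=> i j; rewrite /mulgf /D_x /D_y /d_x /d_y !addrK; ring.
Qed.

(** [Bh] averages the advective and the conservative form of convection. Tested with v, this average
    is exactly a difference of fluxes, each a transporting velocity times two neighbouring values of
    v. On the boundary either the transporting velocity or v itself is zero. *)
Lemma Bh_skew w v : dot_e (Bh Lx Ly w v) v = 0.
Proof.
rewrite dot_e_res.
set U1 := ext_x w.1; set U2 := ext_y w.2; set V1 := ext_x v.1; set V2 := ext_y v.2.
rewrite (@cell_sum_flux _ (fun _ _ => 0)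
  (fun i j => (U1 i j + U1 (i - 1) j) * V1 i j * V1 (i - 1) j / (Lx / Nx%:R) / 4
     + A_y U1 i j * V2 i j * V2 (i - 1) j / (Lx / Nx%:R) / 2)
  (fun i j => (U2 i j + U2 i (j - 1)) * V2 i j * V2 i (j - 1) / (Ly / Ny%:R) / 4
     + A_x U2 i j * V1 i j * V1 i (j - 1) / (Ly / Ny%:R) / 2)).
- by rewrite /cell_sum big1// => i _; rewrite big1.
- by move=> j; rewrite /A_y /U1 /V1 !ext_x_left !(mulr0, mul0r, addr0).
- by move=> j; rewrite /A_y /U1 /V1 !ext_x_right !(mulr0, mul0r, addr0).
- by move=> i; rewrite /A_x /U2 /V2 !ext_y_bottom !(mulr0, mul0r, addr0).
- by move=> i; rewrite /A_x /U2 /V2 !ext_y_top !(mulr0, mul0r, addr0).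
- move=> i j; rewrite /A_x /a_x /A_y /a_y /D_x /d_x /D_y /d_y /mulgf !addrK ?subrK.
  (* The identity is polynomial in the inverse mesh sizes, so these are treated as free
     variables. *)
  by move: (Lx / _)^-1 (Ly / _)^-1 => hx' hy'; field.
Qed.

(** Summation by parts leaves squares of differences, those at vertices being split evenly between
    two adjacent terms. The normal fluxes vanish with the velocity on the boundary; the tangential
    ones contain the average across the boundary, which the odd reflection makes zero. *)
Lemma Ah_v_ge0 v : 0 <= dot_e (Ah_v Lx Ly v) v.
Proof.
rewrite dot_e_res; set V1 := ext_x v.1; set V2 := ext_y v.2.
pose hx := Lx / Nx%:R; pose hy := Ly / Ny%:R.
rewrite (@cell_sum_flux _
  (fun i j =>
    (d_x Lx Nx V1 i j ^+ 2
     + (D_y Ly Ny V1 i (j + 1) ^+ 2 + D_y Ly Ny V1 i j ^+ 2) / 2)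
   + (d_y Ly Ny V2 i j ^+ 2
     + (D_x Lx Nx V2 (i + 1) j ^+ 2 + D_x Lx Nx V2 i j ^+ 2) / 2))
  (fun i j => - (d_x Lx Nx V1 (i - 1) j * V1 i j / hx
                 + D_x Lx Nx V2 i j * A_x V2 i j / hx))
  (fun i j => - (d_y Ly Ny V2 i (j - 1) * V2 i j / hy
                 + D_y Ly Ny V1 i j * A_y V1 i j / hy))).
- apply: sumr_ge0 => i _; apply: sumr_ge0 => j _.
  by do ?[exact: sqr_ge0 | exact: ler0n | apply: addr_ge0 | apply: divr_ge0].
- move=> j; rewrite /A_x /V1 /V2 !ext_x_left add0r ext_y_ghost_left subrr.
  by rewrite !(mulr0, mul0r, addr0) oppr0.
- move=> j; rewrite /A_x /V1 /V2 !ext_x_right ext_y_ghost_right addNr.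
  by rewrite !(mulr0, mul0r, addr0) oppr0.
- move=> i; rewrite /A_y /V1 /V2 !ext_y_bottom add0r ext_x_ghost_bottom subrr.
  by rewrite !(mulr0, mul0r, addr0) oppr0.
- move=> i; rewrite /A_y /V1 /V2 !ext_y_top ext_x_ghost_top addNr.
  by rewrite !(mulr0, mul0r, addr0) oppr0.
- move=> i j; rewrite /A_x /A_y /D_x /d_x /D_y /d_y !addrK ?subrK.
  by rewrite /hx /hy; move: (Lx / _)^-1 (Ly / _)^-1 => hx' hy'; field.
Qed.

Lemma scale_h_adjoint phi v w : dot_e (scale_h phi v) w = dot_e v (scale_h phi w).
Proof.
by congr (_ + _); apply: eq_bigr => i _; apply: eq_bigr => j _;
  rewrite !mxE /mulgf ?ext_x_face ?ext_y_face; ring.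
Qed.

Lemma dot_e_sqr_ge0 v : 0 <= dot_e v v.
Proof. by rewrite addr_ge0 ?mxdot_sqr_ge0. Qed.

Lemma dot_e_sqr_eq0 v : dot_e v v = 0 -> v = 0.
Proof.
case: v => v1 v2 /eqP; rewrite paddr_eq0 ?mxdot_sqr_ge0//=.
by move=> /andP[/eqP/mxdot_sqr_eq0 -> /eqP/mxdot_sqr_eq0 ->].
Qed.

Lemma mxdotC m n (A B : 'M[R]_(m, n)) : mxdot A B = mxdot B A.
Proof. by apply: eq_bigr => i _; apply: eq_bigr => j _; rewrite mulrC. Qed.

Lemma mxdotDl m n (A B C : 'M[R]_(m, n)) : mxdot (A + B) C = mxdot A C + mxdot B C.
Proof.
rewrite /mxdot -big_split; apply: eq_bigr => i _; rewrite -big_split.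
by apply: eq_bigr => j _; rewrite mxE mulrDl.
Qed.

Lemma mxdotZl m n a (A B : 'M[R]_(m, n)) : mxdot (a *: A) B = a * mxdot A B.
Proof.
rewrite /mxdot mulr_sumr; apply: eq_bigr => i _; rewrite mulr_sumr.
by apply: eq_bigr => j _; rewrite mxE mulrA.
Qed.

Lemma mxdotNl m n (A B : 'M[R]_(m, n)) : mxdot (- A) B = - mxdot A B.
Proof. by rewrite -scaleN1r mxdotZl mulN1r. Qed.

Lemma mxdot_mxvec m n (A B : 'M[R]_(m, n)) :
  \sum_k mxvec A 0 k * mxvec B 0 k = mxdot A B.
Proof.
rewrite /mxdot pair_big (reindex _ (curry_mxvec_bij _ _))/=.
by apply: eq_bigr => -[i j] _; rewrite !mxvecE.
Qed.

Lemma mxdot0l m n (A : 'M[R]_(m, n)) : mxdot 0 A = 0.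
Proof. by do 2![apply: big1 => ? _]; rewrite mxE mul0r. Qed.

Lemma dot_e0l v : dot_e 0 v = 0.
Proof. by rewrite /dot_e !mxdot0l addr0. Qed.

Lemma dot_eDl u v w : dot_e (u + v : Eh R Nx Ny) w = dot_e u w + dot_e v w.
Proof. by rewrite /dot_e !mxdotDl addrACA. Qed.

Lemma dot_eZl a u v : dot_e (a *: u : Eh R Nx Ny) v = a * dot_e u v.
Proof. by rewrite /dot_e !mxdotZl mulrDr. Qed.

(** * Mass and the kernel of the discrete gradient *)

Hypotheses (Lx_gt0 : 0 < Lx) (Ly_gt0 : 0 < Ly).

Let hx_gt0 : 0 < Lx / Nx%:R. Proof. by rewrite divr_gt0 ?ltr0n. Qed.
Let hy_gt0 : 0 < Ly / Ny%:R. Proof. by rewrite divr_gt0 ?ltr0n. Qed.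

Lemma mass_hD phi psi :
  mass_h Lx Ly (phi + psi : Ch R Nx Ny) = mass_h Lx Ly phi + mass_h Lx Ly psi.
Proof. by rewrite /mass_h /dot_h -!/(mxdot _ _) mxdotDl mulrDr. Qed.

Lemma mass_hZ a phi :
  mass_h Lx Ly (a *: phi : Ch R Nx Ny) = a * mass_h Lx Ly phi.
Proof. by rewrite /mass_h /dot_h -!/(mxdot _ _) mxdotZl mulrCA. Qed.

Lemma mass_hN phi : mass_h Lx Ly (- phi : Ch R Nx Ny) = - mass_h Lx Ly phi.
Proof. by rewrite -scaleN1r mass_hZ mulN1r. Qed.

Lemma mass_h_const_eq0 c : mass_h Lx Ly (const_mx c : Ch R Nx Ny) = 0 -> c = 0.
Proof.
rewrite /mass_h /dot_h; under eq_bigr.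
  by move=> i _; under eq_bigr do rewrite !mxE mulr1; rewrite sumr_const card_ord; over.
move/eqP; rewrite sumr_const card_ord -mulrnA 2!mulf_eq0 (gt_eqF hx_gt0).
by rewrite (gt_eqF hy_gt0)/= mulrn_eq0 muln_eq0 !gtn_eqF//= => /eqP.
Qed.

Lemma grad_h_const c : grad_h Lx Ly (const_mx c : Ch R Nx Ny) = 0.
Proof.
have ext_const (k l : nat) : (k < Nx)%N -> (l < Ny)%N ->
    ext_c (const_mx c : Ch R Nx Ny) k l = c.
  by move=> kN lN; rewrite (ext_c_cell _ (Ordinal kN) (Ordinal lN)) mxE.
congr pair; apply/matrixP => i j; rewrite !mxE.
  rewrite /D_x addrK (_ : i%:Z + 1 = i.+1); last by lia.
  by rewrite !ext_const ?subrr ?mul0r//; have := ltn_ord i; lia.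
rewrite /D_y addrK (_ : j%:Z + 1 = j.+1); last by lia.
by rewrite !ext_const ?subrr ?mul0r//; have := ltn_ord j; lia.
Qed.

(** Neighbouring cells carry equal values, and every cell is joined to cell (0, 0) by a path in x
    and then in y. *)
Lemma grad_h_eq0 phi : grad_h Lx Ly phi = 0 -> exists c, phi = const_mx c.
Proof.
case=> /matrixP gx /matrixP gy; exists (ext_c phi 0 0).
have stepx (k l : nat) : (k.+1 < Nx)%N -> (l < Ny)%N ->
    ext_c phi k.+1 l = ext_c phi k l.
  move=> kN lN; have k'N : (k < Nx.-1)%N by lia.
  have := gx (Ordinal k'N) (Ordinal lN); rewrite !mxE /D_x addrK /=.
  rewrite (_ : k%:Z + 1 = k.+1); last by lia.
  by move/eqP; rewrite mulf_eq0 invr_eq0 (gt_eqF hx_gt0) orbF subr_eq0 => /eqP.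
have stepy (k l : nat) : (k < Nx)%N -> (l.+1 < Ny)%N ->
    ext_c phi k l.+1 = ext_c phi k l.
  move=> kN lN; have l'N : (l < Ny.-1)%N by lia.
  have := gy (Ordinal kN) (Ordinal l'N); rewrite !mxE /D_y addrK /=.
  rewrite (_ : l%:Z + 1 = l.+1); last by lia.
  by move/eqP; rewrite mulf_eq0 invr_eq0 (gt_eqF hy_gt0) orbF subr_eq0 => /eqP.
apply/matrixP => i j; rewrite mxE -ext_c_cell.
case: i j => k kN [l lN] /=.
elim: k kN => [|k IH] kN; last by rewrite stepx// IH// ltnW.
by elim: l lN => [//|l IH] lN; rewrite stepy// IH// ltnW.
Qed.

Lemma grad_mass_eq0 phi : grad_h Lx Ly phi = 0 -> mass_h Lx Ly phi = 0 -> phi = 0.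
Proof. by move=> /grad_h_eq0[c ->] /mass_h_const_eq0 ->. Qed.

(** Mass is the product with a constant, and the adjoint of the divergence, minus the gradient,
    kills constants. *)
Lemma mass_div_h v : mass_h Lx Ly (div_h Lx Ly v) = 0.
Proof.
rewrite /mass_h /dot_h -/(mxdot _ _) -[mxdot _ _]opprK -grad_div_adjoint.
by rewrite grad_h_const dot_e0l oppr0 mulr0.
Qed.

Lemma mass_h0 : mass_h Lx Ly (0 : Ch R Nx Ny) = 0.
Proof. by rewrite /mass_h /dot_h -/(mxdot _ _) mxdot0l mulr0. Qed.

(** * The linear system of one time step *)

Section Step.
Variables (c eps nu : R) (w : Eh R Nx Ny) (s : Ch R Nx Ny).
Hypotheses (c_gt0 : 0 < c) (eps_gt0 : 0 < eps) (nu_gt0 : 0 < nu).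

Let state : Type := (Eh R Nx Ny * Ch R Nx Ny * Ch R Nx Ny * Ch R Nx Ny)%type.

(* The mass of the pressure is added to the divergence equation to make the
   system square: both vanish as soon as their sum does. *)
Definition step_op (X : state) : state :=
  let: (u, p, phi, mu) := X in
  (c *: u + Bh Lx Ly w u + nu *: Ah_v Lx Ly u + grad_h Lx Ly p
     + scale_h s (grad_h Lx Ly mu),
   div_h Lx Ly u + const_mx (mass_h Lx Ly p),
   c *: phi + Ah_c Lx Ly mu + div_h Lx Ly (scale_h s u),
   mu - eps ^+ 2 *: Ah_c Lx Ly phi).

Lemma step_opP u p phi mu f g h :
  step_op (u, p, phi, mu) = (f, 0, g, h) <->
  [/\ c *: u + Bh Lx Ly w u + nu *: Ah_v Lx Ly u + grad_h Lx Ly p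
        + scale_h s (grad_h Lx Ly mu) = f,
      div_h Lx Ly u = 0,
      c *: phi + Ah_c Lx Ly mu + div_h Lx Ly (scale_h s u) = g,
      mu - eps ^+ 2 *: Ah_c Lx Ly phi = h
    & mass_h Lx Ly p = 0].
Proof.
have const0 : const_mx 0 = 0 :> Ch R Nx Ny by apply/matrixP => i j; rewrite !mxE.
split=> [[eq_u eq_div eq_phi eq_mu]|[eq_u div_u eq_phi eq_mu mass_p]]; last first.
  by rewrite /step_op eq_u div_u eq_phi eq_mu mass_p const0 addr0.
(* A divergence has zero mass, so the mass of the second component is that of the added constant
   alone. *)
have mass_p : mass_h Lx Ly p = 0.
  apply: mass_h_const_eq0.
  have := congr1 (@mass_h R Lx Ly Nx Ny) eq_div.
  by rewrite mass_hD mass_div_h add0r mass_h0.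
by split=> //; move: eq_div; rewrite mass_p const0 addr0.
Qed.

Lemma step_op_linear a X Y : step_op (a *: X + Y) = a *: step_op X + step_op Y.
Proof.
case: X Y => [[[u p] phi] mu] [[[u' p'] phi'] mu'].
have addrE : forall (V : lmodType R) (x1 x2 y1 y2 : V),
  (a *: x1 + x2) + (a *: y1 + y2) = a *: (x1 + y1) + (x2 + y2).
  by move=> V x1 x2 y1 y2; rewrite addrACA scalerDr.
rewrite /step_op /=; congr (_, _, _, _).
- rewrite Bh_D Ah_vD !grad_hD scale_hD !scalerDr !scalerA ![nu * a]mulrC ![c * a]mulrC.
  by rewrite -!scalerA !addrE.
- rewrite div_hD mass_hD mass_hZ -addrE; congr (_ + _).
  by apply/matrixP => i j; rewrite !mxE.
- rewrite Ah_cD scale_hD div_hD !scalerDr !scalerA [c * a]mulrC.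
  by rewrite -!scalerA !addrE.
- rewrite Ah_cD !scalerDr !scalerA [_ * a]mulrC -!scalerA opprD -scalerN.
  by rewrite addrE.
Qed.

(** The energy identity in the form used three times: r = 0 gives injectivity of [step_op], a
    general r gives the sign conditions on the map from r to [phi], and a difference of two
    nonlinear terms gives uniqueness. *)
Lemma step_op_energy u p phi mu r :
  step_op (u, p, phi, mu) = (0, 0, 0, r) ->
  mxdot phi r <= 0 /\
  (0 <= mxdot phi r -> (u, p, phi, mu) = (0, 0, 0, r) :> state).
Proof.
move=> /step_opP[eq_u div_u eq_phi eq_mu mass_p].
have energy_u : c * dot_e u u + nu * dot_e (Ah_v Lx Ly u) u =
    mxdot (div_h Lx Ly (scale_h s u)) mu.
  have := congr1 (dot_e^~ u) eq_u.
  rewrite dot_e0l !dot_eDl !dot_eZl Bh_skew grad_div_adjoint div_u mxdot0l.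
  rewrite scale_h_adjoint grad_div_adjoint oppr0 !addr0.
  by move/eqP; rewrite subr_eq0 => /eqP.
have energy_phi : c * mxdot phi mu + dot_e (grad_h Lx Ly mu) (grad_h Lx Ly mu)
    + mxdot (div_h Lx Ly (scale_h s u)) mu = 0.
  have := congr1 (fun x : Ch R Nx Ny => mxdot x mu) eq_phi.
  by rewrite mxdot0l !mxdotDl mxdotZl mxdotNl -grad_div_adjoint.
have energy_mu : mxdot phi mu =
    eps ^+ 2 * dot_e (grad_h Lx Ly phi) (grad_h Lx Ly phi) + mxdot phi r.
  rewrite mxdotC [mxdot phi r]mxdotC -eq_mu mxdotDl mxdotNl mxdotZl mxdotNl.
  by rewrite -grad_div_adjoint addrC subrK.
(* The energy controls only the gradient of [phi]; testing the phase equation with a constant fixes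
   the remaining additive constant. *)
have mass_phi : mass_h Lx Ly phi = 0.
  have := congr1 (@mass_h R Lx Ly Nx Ny) eq_phi.
  rewrite mass_h0 !mass_hD mass_hN !mass_div_h mass_hZ oppr0 !addr0.
  by move/eqP; rewrite mulf_eq0 (gt_eqF c_gt0) => /eqP.
have uu_ge0 : 0 <= c * dot_e u u by rewrite mulr_ge0 ?dot_e_sqr_ge0 ?ltW.
have Auu_ge0 : 0 <= nu * dot_e (Ah_v Lx Ly u) u by rewrite mulr_ge0 ?Ah_v_ge0 ?ltW.
have mumu_ge0 := dot_e_sqr_ge0 (grad_h Lx Ly mu).
have phiphi_ge0 := dot_e_sqr_ge0 (grad_h Lx Ly phi).
have eps2_gt0 : 0 < c * eps ^+ 2 by rewrite mulr_gt0 ?exprn_gt0.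
have balance : c * dot_e u u + nu * dot_e (Ah_v Lx Ly u) u
    + dot_e (grad_h Lx Ly mu) (grad_h Lx Ly mu)
    + c * eps ^+ 2 * dot_e (grad_h Lx Ly phi) (grad_h Lx Ly phi)
    + c * mxdot phi r = 0.
  by move: energy_phi; rewrite energy_mu -energy_u => <-; ring.
have cphi_ge0 := mulr_ge0 (ltW eps2_gt0) phiphi_ge0.
split=> [|r_ge0].
  by rewrite -(pmulr_rle0 _ c_gt0); lra.
have cr_ge0 := mulr_ge0 (ltW c_gt0) r_ge0.
have u0 : u = 0.
  apply: dot_e_sqr_eq0; apply: (mulfI (lt0r_neq0 c_gt0)); rewrite mulr0; lra.
have gmu0 : grad_h Lx Ly mu = 0 by apply: dot_e_sqr_eq0; lra.
have phi0 : phi = 0.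
  apply: grad_mass_eq0 mass_phi; apply: dot_e_sqr_eq0.
  by apply: (mulfI (lt0r_neq0 eps2_gt0)); rewrite mulr0; lra.
have mu_r : mu = r.
  by rewrite -eq_mu phi0 (linear_map0 Ah_cD) scaler0 subr0.
(* Once u and the gradient of [mu] vanish, the momentum equation reduces to [grad_h p = 0], and the
   normalization excludes constants. *)
have p0 : p = 0.
  apply: grad_mass_eq0 mass_p; move: eq_u.
  rewrite u0 gmu0 (linear_map0 (scale_hD^~ s)) (linear_map0 (Bh_D^~ w)).
  by rewrite (linear_map0 Ah_vD) !scaler0 !addr0 !add0r.
by rewrite u0 p0 phi0 mu_r.
Qed.

Lemma step_op_eq0 (X : state) : step_op X = 0 -> X = 0.
Proof.
case: X => [[[u p] phi] mu] /step_op_energy[_]; apply.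
by rewrite mxdotC mxdot0l.
Qed.

Lemma step_op_inverse : exists2 J : state -> state,
  forall a (X Y : state), J (a *: X + Y) = a *: J X + J Y & cancel J step_op.
Proof. exact: linear_inverse step_op_linear step_op_eq0. Qed.

(** By superposition, an extra source r in the last equation changes [phi] by K r. It remains to
    choose r equal to the nonlinear term at the resulting [phi], which after flattening matrices to
    row vectors is an instance of [monotone_fixpoint]. *)
Lemma step_op_solvable (f : Eh R Nx Ny) (g h a b : Ch R Nx Ny) :
  exists u p phi mu, step_op (u, p, phi, mu) =
    (f, 0, g, h + \matrix_(i, j) chi (3 / 2 * phi i j + a i j) (b i j)).
Proof.
have [J J_lin JK] := step_op_inverse.
pose X0 := J (f, 0, g, h).
pose K (r : Ch R Nx Ny) : Ch R Nx Ny := (J (0, 0, 0, r)).1.2.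
have embD (t : R) (r r' : Ch R Nx Ny) :
    (0, 0, 0, t *: r + r') = t *: (0, 0, 0, r) + (0, 0, 0, r') :> state.
  by rewrite -[RHS]/(t *: 0 + 0, t *: 0 + 0, t *: 0 + 0, t *: r + r') !scaler0 !addr0.
have K_energy r : mxdot (K r) r <= 0 /\ (0 <= mxdot (K r) r -> K r = 0).
  have := JK (0, 0, 0, r); rewrite /K.
  case: (J _) => [[[u p] phi] mu] /step_op_energy[le0 eq0] /=.
  by split=> // /eq0[].
have Kv_lin : linear (fun v : 'rV[R]_(Nx * Ny) => mxvec (K (vec_mx v))).
  by move=> t v v'; rewrite linearP /K embD J_lin linearP.
pose Kv : {linear 'rV[R]_(Nx * Ny) -> 'rV[R]_(Nx * Ny)} :=
  HB.pack (fun v : 'rV[R]_(Nx * Ny) => mxvec (K (vec_mx v)))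
    (GRing.isLinear.Build R _ _ _ _ Kv_lin).
have KvE z : z *m lin1_mx Kv = mxvec (K (vec_mx z)) by rewrite mul_rV_lin1.
have dotE z : \sum_k (z *m lin1_mx Kv) 0 k * z 0 k = mxdot (K (vec_mx z)) (vec_mx z).
  by rewrite KvE -mxdot_mxvec vec_mxK.
(* The part of [phi] due to the data alone is absorbed into the shift, so that the fixed-point
   equation involves only K r. *)
pose a' := mxvec (3 / 2 *: X0.1.2 + a).
have [||k x|k x|k M|r rE] := @monotone_fixpoint R (Nx * Ny) (lin1_mx Kv)
    (fun k x => chi (3 / 2 * x + a' 0 k) (mxvec b 0 k))
    (fun k x => 3 / 8 * (2 * (3 / 2 * x + a' 0 k) ^+ 2
                         + ((3 / 2 * x + a' 0 k) + mxvec b 0 k) ^+ 2)).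
- by move=> v; rewrite dotE; case: (K_energy (vec_mx v)).
- move=> v; rewrite dotE KvE => v0; case: (K_energy (vec_mx v)) => _.
  by rewrite v0 lexx => ->//; rewrite linear0.
- exact: is_derive_chi_affine.
- by rewrite mulr_ge0 ?divr_ge0// addr_ge0 ?sqr_ge0// mulr_ge0 ?sqr_ge0.
- exact: chi_affine_coercive.
have := JK ((f, 0, g, h) + (0, 0, 0, vec_mx r)).
have -> : J ((f, 0, g, h) + (0, 0, 0, vec_mx r)) = X0 + J (0, 0, 0, vec_mx r).
  by rewrite -[(f, 0, g, h) in LHS]scale1r J_lin scale1r.
have phiE : (X0 + J (0, 0, 0, vec_mx r)).1.2 = X0.1.2 + K (vec_mx r) by [].
move: phiE; case: (X0 + _) => [[[u p] phi] mu] /= phiE stepE.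
exists u, p, phi, mu; rewrite stepE.
rewrite -[LHS]/(f + 0, 0 + 0, g + 0, h + vec_mx r) !addr0; congr (_, _, _, h + _).
apply/matrixP => i j; rewrite [LHS]mxE rE KvE !mxvecE [RHS]mxE phiE !mxE.
by congr chi; ring.
Qed.

End Step.

(** * Existence, uniqueness and mass balance for one step of the scheme *)

Lemma D2tauE (V : lmodType R) (tau : R) (q0 q1 q2 : V) :
  D2tau tau q0 q1 q2 = 3 / (2 * tau) *: q2 - (2 * tau)^-1 *: (4 *: q1 - q0).
Proof.
rewrite -[in RHS]scalerN opprB /D2tau -addrA [- _ + q0]addrC.
by rewrite scalerDr scalerA [_^-1 * 3]mulrC.
Qed.

Lemma chi_h_dagger phi0 phi1 (b : Ch R Nx Ny) :
  chi_h (dagger phi0 phi1) b =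
  \matrix_(i, j) chi (3 / 2 * phi1 i j + (- 2^-1 *: phi0) i j) (b i j).
Proof. by apply/matrixP => i j; rewrite !mxE; congr chi; ring. Qed.

Section Scheme.
Variables (tau eps nu : R) (u0 u1 : Eh R Nx Ny) (phi0 phi1 : Ch R Nx Ny).
Hypotheses (tau_gt0 : 0 < tau) (eps_gt0 : 0 < eps) (nu_gt0 : 0 < nu).

Let scheme := cs_bdf2_step Lx Ly tau eps nu u0 u1 phi0 phi1.
Let op := step_op (3 / (2 * tau)) eps nu (star u0 u1) (star phi0 phi1).
Let reaction (phi : Ch R Nx Ny) : Ch R Nx Ny :=
  chi_h (dagger phi1 phi) (dagger phi0 phi1).

Let c_gt0 : 0 < 3 / (2 * tau). Proof. by rewrite divr_gt0 ?mulr_gt0. Qed.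

Lemma cs_bdf2_stepE u p phi mu :
  scheme u p phi mu <->
  op (u, p, phi, mu) =
    ((2 * tau)^-1 *: (4 *: u1 - u0), 0, (2 * tau)^-1 *: (4 *: phi1 - phi0),
     - star phi0 phi1 + reaction phi).
Proof.
have subE (V : zmodType) (x y : V) : x - y = 0 <-> x = y.
  by split=> [/eqP|->]; rewrite ?subrr// subr_eq0 => /eqP.
have momentumE (V : zmodType) (x k y z p' q : V) :
    x - k + y + z + p' + q = 0 <-> x + y + z + p' + q = k.
  by rewrite !(addrAC _ (- k)); exact: subE.
have phaseE (V : zmodType) (x k y z : V) : x - k + y + z = 0 <-> x + y + z = k.
  by rewrite !(addrAC _ (- k)); exact: subE.
have potentialE (V : zmodType) (x y z : V) : x - y + z = 0 <-> x = - z + y.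
  rewrite -subE (_ : x - (- z + y) = x - y + z)//.
  by rewrite opprD opprK addrA addrAC.
rewrite step_opP /scheme /cs_bdf2_step !D2tauE.
split=> -[eq_u div_u eq_phi eq_mu mass_p]; split=> //.
- exact: (momentumE _ _ _ _ _ _ _).1 eq_u.
- exact: (phaseE _ _ _ _ _).1 eq_phi.
- exact: (potentialE _ _ _ _).1 eq_mu.
- exact: (momentumE _ _ _ _ _ _ _).2 eq_u.
- exact: (phaseE _ _ _ _ _).2 eq_phi.
- exact: (potentialE _ _ _ _).2 eq_mu.
Qed.

Lemma cs_bdf2_step_exists : exists u p phi mu, scheme u p phi mu.
Proof.
have [u [p [phi [mu E]]]] := step_op_solvable (star u0 u1) (star phi0 phi1)
  c_gt0 eps_gt0 nu_gt0 ((2 * tau)^-1 *: (4 *: u1 - u0))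
  ((2 * tau)^-1 *: (4 *: phi1 - phi0)) (- star phi0 phi1)
  (- 2^-1 *: phi1) (dagger phi0 phi1).
by exists u, p, phi, mu; apply/cs_bdf2_stepE; rewrite /reaction chi_h_dagger.
Qed.

Lemma cs_bdf2_step_unique u p phi mu u' p' phi' mu' :
  scheme u p phi mu -> scheme u' p' phi' mu' ->
  (u, p, phi, mu) = (u', p', phi', mu').
Proof.
move=> /cs_bdf2_stepE E /cs_bdf2_stepE E'.
have cancel_left (V : zmodType) (x y z : V) : - (x + y) + (x + z) = z - y.
  by rewrite opprD addrACA addNr add0r addrC.
have diff : op (u - u', p - p', phi - phi', mu - mu') =
    (0, 0, 0, reaction phi - reaction phi').
  have -> : (u - u', p - p', phi - phi', mu - mu') =
      -1 *: (u', p', phi', mu') + (u, p, phi, mu).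
    by congr (_, _, _, _); rewrite scaleN1r addrC.
  rewrite /op step_op_linear -!/op E E'; congr (_, _, _, _); rewrite scaleN1r ?addNr//.
  exact: cancel_left.
have [_ react_ge0] := step_op_energy c_gt0 eps_gt0 nu_gt0 diff.
(* Monotonicity of [chi] gives the sign opposite to that of the energy identity, so all differences
   vanish except possibly that of [mu]. *)
have : 0 <= mxdot (phi - phi') (reaction phi - reaction phi').
  rewrite /reaction !chi_h_dagger.
  do 2![apply: sumr_ge0 => ? _]; rewrite !mxE; exact: chi_affine_monotone.
move=> /react_ge0 eq0.
have uE : u = u' := subr0_eq (congr1 (fun X => X.1.1.1) eq0).
have pE : p = p' := subr0_eq (congr1 (fun X => X.1.1.2) eq0).
have phiE : phi = phi' := subr0_eq (congr1 (fun X => X.1.2) eq0).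
(* The difference of the potentials equals that of the nonlinear terms, which vanishes because [phi]
   and [phi'] agree. *)
have muE : mu - mu' = reaction phi - reaction phi' := congr1 snd eq0.
by rewrite uE pE phiE (subr0_eq (etrans muE _)) ?phiE ?subrr.
Qed.

(** Apart from the time difference, every term of the phase equation is a divergence, so the masses
    obey the bare three-term recurrence of BDF2. *)
Lemma cs_bdf2_step_mass u p phi mu : scheme u p phi mu ->
  3 * mass_h Lx Ly phi = 4 * mass_h Lx Ly phi1 - mass_h Lx Ly phi0.
Proof.
case=> _ _ /(congr1 (@mass_h R Lx Ly Nx Ny)) + _ _.
rewrite mass_h0 !mass_hD mass_hN !mass_div_h oppr0 !addr0 /D2tau.
rewrite mass_hZ !mass_hD mass_hN !mass_hZ => /eqP.
rewrite mulf_eq0 invr_eq0 gt_eqF ?mulr_gt0//= => /eqP; lra.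
Qed.

End Scheme.
End Operators.

(** * Induction over the time steps *)

Theorem theorem3p2 (R : realType) (Lx Ly T eps nu : R) (Nx Ny N : nat)
    (hLx : 0 < Lx) (hLy : 0 < Ly) (hNx : (0 < Nx)%N) (hNy : (0 < Ny)%N)
    (hT : 0 < T) (hN : (2 <= N)%N) (heps : 0 < eps) (hnu : 0 < nu)
    (u : nat -> Eh R Nx Ny) (p phi mu : nat -> Ch R Nx Ny)
    (hmass : mass_h Lx Ly (phi 1%N) = mass_h Lx Ly (phi 0%N))
    (hdiv0 : div_h Lx Ly (u 0%N) = 0) (hdiv1 : div_h Lx Ly (u 1%N) = 0)
    (n : nat) (hn : (1 <= n <= N - 1)%N)
    (hprev : forall k : nat, (1 <= k < n)%N ->
       cs_bdf2_step Lx Ly (T / N%:R) eps nu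
         (u k.-1) (u k) (phi k.-1) (phi k)
         (u k.+1) (p k.+1) (phi k.+1) (mu k.+1)) :
  let scheme := cs_bdf2_step Lx Ly (T / N%:R) eps nu
                  (u n.-1) (u n) (phi n.-1) (phi n) in
  (exists! s : Eh R Nx Ny * Ch R Nx Ny * Ch R Nx Ny * Ch R Nx Ny,
     let: (u', p', phi', mu') := s in scheme u' p' phi' mu') /\
  (forall (u' : Eh R Nx Ny) (p' phi' mu' : Ch R Nx Ny),
     scheme u' p' phi' mu' ->
     mass_h Lx Ly phi' = mass_h Lx Ly (phi n) /\
     mass_h Lx Ly (phi n) = mass_h Lx Ly (phi 0%N)).
Proof.
have hT' : 0 < T / N%:R by rewrite divr_gt0 ?ltr0n//; lia.
move=> scheme.
(* The recurrence involves two earlier masses, so the induction carries two consecutive ones; it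
   starts from the equality of the two initial masses. *)
have mass_step m : (m < n)%N -> mass_h Lx Ly (phi m.+1) = mass_h Lx Ly (phi 0%N)
    /\ mass_h Lx Ly (phi m) = mass_h Lx Ly (phi 0%N).
  elim: m => [//|m IH] mn; have [m1 m0] := IH (ltnW mn).
  have := cs_bdf2_step_mass hNx hNy hLx hLy hT' (hprev m.+1 mn); rewrite /= => E.
  by split=> //; lra.
have [mass_n mass_n1] : mass_h Lx Ly (phi n) = mass_h Lx Ly (phi 0%N)
    /\ mass_h Lx Ly (phi n.-1) = mass_h Lx Ly (phi 0%N).
  by case: n hn mass_step {hprev scheme} => [//|m] _ /(_ m (ltnSn m)).
split; last first.
  move=> u' p' phi' mu' /(cs_bdf2_step_mass hNx hNy hLx hLy hT') E.
  by split=> //; lra.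
have [u' [p' [phi' [mu' sol]]]] := cs_bdf2_step_exists hNx hNy hLx hLy
  (u n.-1) (u n) (phi n.-1) (phi n) hT' heps hnu.
exists (u', p', phi', mu'); split=> // -[[[u2 p2] phi2] mu2] sol2.
exact: (cs_bdf2_step_unique hNx hNy hLx hLy hT' heps hnu sol sol2).
Qed.
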